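(* Let $s\ge 1$ be an integer, let $N$ be a positive integer that is a multiple of neither $2$ nor $3$, let $C>1$, and let $\Omega$ be a random subset of $\mathbb{Z}/N\mathbb{Z}$ obtained by random selection of parameter $\tau\in(0,1)$, where $$E(|\Omega|)=\tau N=4C(s^2+1)\log N .$$ Let $\nu\ge 3$ be an integer, $a=\cos\frac{\pi}{\nu}$ and $\delta=Ca^2-1$. Then $$P\Big(|K(t)|<\tfrac{1}{2s}K(0)\ \text{ for every } t\in\mathbb{Z}/N\mathbb{Z},\ t\ne 0\Big)>1-\nu N^{-\delta},$$ where $K(t)=\sum_{\omega\in\Omega}e\big(\frac{\omega t}{N}\big)$.
   Context: $e(u)=\exp(2\pi i u)$ and $\log$ is the natural logarithm. ''Random selection of parameter $\tau$ on $\mathbb{Z}/N\mathbb{Z}$'' means that the events $(n\in\Omega)$, $n\in\mathbb{Z}/N\mathbb{Z}$, are independent and each has probability $\tau$. *)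

(* Defs.v *)
From HB Require Import structures.
From mathcomp Require Import all_boot all_order all_algebra.
From mathcomp Require Import all_classical all_reals all_analysis.
From mathcomp Require Import complex.

Set Implicit Arguments.
Unset Strict Implicit.
Unset Printing Implicit Defensive.

Import Order.TTheory GRing.Theory Num.Theory.

Local Open Scope classical_set_scope.
Local Open Scope ring_scope.

(* e(u) = exp (2 pi i u), written with Euler's formula since the library has no
   complex exponential. *)
Definition e (R : realType) (u : R) : R[i] :=
  (cos (2 * pi * u) +i* sin (2 * pi * u))%C.

(* omega and t are read through their representatives in [0, N[; since e is
   1-periodic, the value does not depend on the choice of representatives.
   'Z_N is Z/NZ only for 1 < N. *)
Definition K (R : realType) (N : nat) (Omega : {set 'Z_N}) (t : 'Z_N) : R[i] :=
  \sum_(omega in Omega) e ((omega * t)%N%:R / N%:R : R).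
Arguments K R {N} Omega t.

Definition independent_events d (T : measurableType d) (R : realType)
    (P : probability T R) (I : finType) (E : I -> set T) : Prop :=
  (forall i, measurable (E i)) /\
  (forall J : {set I},
    P (\bigcap_(i in [set i | i \in J]) E i) = (\prod_(i in J) P (E i))%E).

Definition random_selection d (T : measurableType d) (R : realType)
    (P : probability T R) (I : finType) (tau : R) (Omega : T -> {set I}) : Prop :=
  independent_events P (fun n : I => [set x | n \in Omega x]) /\
  (forall n : I, P [set x | n \in Omega x] = tau%:E).

(* Main.v *)
Require Import Defs.
From HB Require Import structures.
From mathcomp Require Import all_boot all_order all_algebra.
From mathcomp Require Import all_classical all_reals all_analysis.
From mathcomp Require Import complex.
From mathcomp Require Import ring lra.

Set Implicit Arguments.
Unset Strict Implicit.
Unset Printing Implicit Defensive.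

Import Order.TTheory GRing.Theory Num.Theory.
Import numFieldNormedType.Exports.

Local Open Scope classical_set_scope.
Local Open Scope ring_scope.

(** By independence, the expectation of the product of f(n) over n in Omega is
    the product over all n of 1 + tau (f(n) - 1).  With f(n) = exp (lambda X_n),
    this gives the Chernoff bound
      P(sum over Omega of X_n >= 0) <= exp (tau sum_n (exp (lambda X_n) - 1)).
    If |K(t)| >= K(0) / (2 s), then one of the nu vertex directions theta of a
    regular nu-gon satisfies Re (e^(-i theta) K(t)) >= b K(0) with b = a / (2 s),
    so the bound applies to X_n = cos (2 pi n t / N - theta) - b, with
    lambda = 2 b <= 1.  Since N is prime to 6 and t <> 0, the cosines have the
    first three moments 0, 1/2, 0 over Z/NZ, and a fourth-order expansion of exp
    bounds the probability of each direction by N^(-C a^2).  There are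
    (N - 1) nu pairs (t, theta). *)

(** * Taylor bounds for the exponential *)

Lemma expR_ge_deg2 (R : realType) (x : R) : 0 <= x -> 1 + x + x ^+ 2 / 2 <= expR x.
Proof.
move=> x0; have ndx : nondecreasing_seq (series (exp_coeff x)).
  by apply/nondecreasing_series => n _ _; exact: exp_coeff_ge0.
have := nondecreasing_cvgn_le ndx (is_cvg_series_exp_coeff x) 3%N.
rewrite /series /= !big_nat_recr//= big_geq// /exp_coeff/= !fact0 /=.
rewrite /factorial/= expr0 expr1 add0r !divr1 //.
Qed.

(** Since (n + 4)! >= 24 * 2^n and |x| <= 1, the terms from degree 4 on are dominated by a geometric
    series of sum x^4 / 12; the constant 1/4 leaves room. *)
Lemma expR_le_deg4 (R : realType) (x : R) : `|x| <= 1 ->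
  expR x <= 1 + x + x ^+ 2 / 2 + x ^+ 3 / 6 + x ^+ 4 / 4.
Proof.
move=> x1.
have partial n : series (exp_coeff x) (n + 4)%N <=
    1 + x + x ^+ 2 / 2 + x ^+ 3 / 6 + x ^+ 4 / 12 * (1 - 2^-1 ^+ n).
  elim: n => [|n IHn].
    by rewrite /series /= !big_nat_recr//= big_geq// /exp_coeff/=;
      rewrite /factorial/= expr0 subrr mulr0 expr1 add0r !divr1 addr0.
  rewrite addSn /series /= big_nat_recr//=; move: IHn; rewrite /series/= => IHn.
  have fact_ge : (24 * 2 ^ n <= (n + 4)`!)%N.
    elim: n {IHn} => // n IHn.
    by rewrite addSn factS expnS mulnCA leq_mul// addnS.
  have : exp_coeff x (n + 4)%N <= x ^+ 4 / 24 * 2^-1 ^+ n.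
    rewrite /exp_coeff /=.
    have x4 : 0 <= x ^+ 4 by rewrite exprn_even_ge0.
    apply: (@le_trans _ _ (x ^+ 4 / (n + 4)%N`!%:R)).
      rewrite ler_wpM2r ?invr_ge0// exprD.
      apply: (le_trans (ler_norm _)); rewrite normrM normrX.
      by rewrite [X in _ * X]ger0_norm// ler_piMl// exprn_ile1.
    rewrite -mulrA ler_wpM2l// exprVn -invfM -natrX -natrM.
    by rewrite lef_pV2 ?posrE ?ltr0n ?fact_gt0 ?muln_gt0 ?expn_gt0// ler_nat.
  rewrite [2^-1 ^+ n.+1]exprS; set y := 2^-1 ^+ n in IHn *; set z := \sum_(_ <= _ < _) _ in IHn *.
  by lra.
apply: limr_le; first exact: is_cvg_series_exp_coeff.
near=> m; have /subnK <- : (4 <= m)%N by near: m; exact: nbhs_infty_ge.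
apply: (le_trans (partial _)); rewrite lerD2l.
have x4 : 0 <= x ^+ 4 by rewrite exprn_even_ge0.
have : 0 <= (2^-1 : R) ^+ (m - 4) by rewrite exprn_ge0// invr_ge0.
nra.
Unshelve. all: by end_near. Qed.

(** * Vanishing of cosine sums over a full period *)

Lemma sin_pi_frac_neq0 (R : realType) (m n : nat) : (0 < n)%N -> ~~ (n %| m)%N ->
  sin (pi * m%:R / n%:R : R) != 0.
Proof.
move=> n0 nm.
have n0' : (n%:R : R) != 0 by rewrite pnatr_eq0 -lt0n.
have -> : pi * m%:R / n%:R = pi * (m %% n)%N%:R / n%:R + pi *+ (m %/ n) :> R.
  by rewrite {1}(divn_eq m n) natrD natrM -[pi *+ _]mulr_natr; field.
rewrite (alternatingn (@sinDpi R)) mulf_neq0 ?signr_eq0// gt_eqF// sin_gt0_pi//.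
have r0 : 0 < (m %% n)%N%:R :> R by rewrite ltr0n lt0n.
apply/andP; split; first by rewrite divr_gt0 ?ltr0n// mulr_gt0 ?pi_gt0.
by rewrite ltr_pdivrMr ?ltr0n// ltr_pM2l ?pi_gt0// ltr_nat ltn_mod.
Qed.

(* Multiplying by [sin (pi m / n)] makes the sum telescope. *)
Lemma sum_cos_eq0 (R : realType) (m n : nat) (phi : R) : (0 < n)%N -> ~~ (n %| m)%N ->
  \sum_(i < n) cos (2 * pi * (i * m)%N%:R / n%:R + phi) = 0.
Proof.
move=> n0 nm; have n0' : (n%:R : R) != 0 by rewrite pnatr_eq0 -lt0n.
set h : R := pi * m%:R / n%:R.
apply: (mulfI (sin_pi_frac_neq0 R n0 nm)); rewrite mulr0 -/h.
(* From 2 sin h cos y = sin (y + h) - sin (y - h), with y = phi + 2 i h. *)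
pose g (i : nat) := sin (phi + (2 * i%:R - 1) * h) / 2.
have step (i : nat) : sin h * cos (2 * pi * (i * m)%N%:R / n%:R + phi) = g i.+1 - g i.
  have -> : 2 * pi * (i * m)%N%:R / n%:R + phi = phi + 2 * i%:R * h.
    by rewrite /h natrM; field.
  rewrite /g.
  have -> : phi + (2 * i.+1%:R - 1) * h = phi + 2 * i%:R * h + h.
    by rewrite -natr1; ring.
  have -> : phi + (2 * i%:R - 1) * h = phi + 2 * i%:R * h - h by ring.
  by rewrite sinD sinB; field.
rewrite mulr_sumr (eq_bigr (fun i : 'I_n => g i.+1 - g i)); last by move=> i _; exact: step.
rewrite -(big_mkord xpredT (fun i => g i.+1 - g i)).
rewrite telescope_sumr// /g; apply/eqP; rewrite subr_eq0; apply/eqP; congr (_ / 2).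
(* The two endpoints differ by 2 n h = 2 pi m, a multiple of the period. *)
have -> : phi + (2 * n%:R - 1) * h = phi + (2 * 0%:R - 1) * h + pi *+ 2 *+ m.
  by rewrite /h -mulr_natr -(mulr_natr pi 2); field.
by rewrite (periodicn (@sinD2pi R)).
Qed.

(** * Polar coordinates and the vertex directions of a regular polygon *)

Lemma polar_form (R : realType) (x y : R) : exists2 phi : R, 0 <= phi <= 2 * pi &
  x = Num.sqrt (x ^+ 2 + y ^+ 2) * cos phi /\ y = Num.sqrt (x ^+ 2 + y ^+ 2) * sin phi.
Proof.
set r := Num.sqrt _.
have r2 : r ^+ 2 = x ^+ 2 + y ^+ 2 by rewrite sqr_sqrtr// addr_ge0 ?sqr_ge0.
have [r0|rn0] := eqVneq r 0.
  exists 0; first by rewrite lexx mulr_ge0 ?pi_ge0.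
  move: r2; rewrite r0 expr0n/= => /esym/eqP; rewrite paddr_eq0 ?sqr_ge0// !sqrf_eq0.
  by rewrite !mul0r => /andP[/eqP-> /eqP->].
have r_gt0 : 0 < r by rewrite lt_def rn0 sqrtr_ge0.
have u1 : (x / r) ^+ 2 = 1 - (y / r) ^+ 2.
  by rewrite !expr_div_n r2; field; rewrite -r2 sqrf_eq0.
have u_itv : -1 <= x / r <= 1.
  by rewrite -ler_norml -(@expr_le1 _ 2)// real_normK ?num_real// u1 gerBl sqr_ge0.
have ca : cos (acos (x / r)) = x / r by rewrite acosK// in_itv.
have sa : sin (acos (x / r)) = `|y| / r.
  by rewrite sin_acos// u1 opprB addrC subrK sqrtr_sqr normrM normfV (gtr0_norm r_gt0).
have := acos_ge0 u_itv; have := acos_lepi u_itv; set p := acos _ in ca sa *.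
have pi0 := pi_gt0 R.
move=> p1 p0; have [y0|y0] := leP 0 y.
  exists p; first lra.
  by rewrite ca sa ger0_norm// ![r * _]mulrC !divfK.
exists (- p + pi *+ 2); first by rewrite -mulr_natl; lra.
rewrite cosD2pi sinD2pi cosN sinN ca sa ltr0_norm// ![r * _]mulrC.
by rewrite -mulNr opprK !divfK.
Qed.

Lemma cos_le_of_norm_le (R : realType) (x h : R) : h <= pi -> `|x| <= h -> cos h <= cos x.
Proof.
move=> hpi xh; rewrite -(cos_norm x); have h0 : 0 <= h by apply: le_trans xh.
by rewrite leNgt ltr_cos ?in_itv/= ?h0 ?normr_ge0 -?leNgt//= (le_trans xh).
Qed.

(* Some vertex direction of the nu-gon is within [pi / nu] of the argument of
   [x + iy]. *)
Lemma polygon_direction (R : realType) (nu : nat) (x y : R) : (0 < nu)%N ->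
  exists j : 'I_nu, cos (pi / nu%:R) * Num.sqrt (x ^+ 2 + y ^+ 2) <=
    x * cos (2 * pi * j%:R / nu%:R) + y * sin (2 * pi * j%:R / nu%:R).
Proof.
move=> nu0; have [phi /andP[phi0 phi2] [xE yE]] := polar_form x y.
have nu0' : 0 < nu%:R :> R by rewrite ltr0n.
have pi0 := pi_gt0 R.
set r := Num.sqrt _ in xE yE *.
have r0 : 0 <= r by exact: sqrtr_ge0.
(* Adding 1/2 before truncation rounds phi nu / (2 pi) to a nearest integer [k], so the angle error
   is at most half of 2 pi / nu. *)
pose w := phi * nu%:R / (2 * pi) + 2^-1.
have w0 : 0 <= w by rewrite addr_ge0// divr_ge0 ?mulr_ge0// ltW.
pose k := Num.trunc w.
have /andP[kw wk] : k%:R <= w < k.+1%:R by exact: truncn_itv.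
have close : `|phi - 2 * pi * k%:R / nu%:R| <= pi / nu%:R.
  have -> : phi - 2 * pi * k%:R / nu%:R = (w - 2^-1 - k%:R) * (2 * (pi / nu%:R)).
    by move: (lt0r_neq0 pi0); rewrite /w; move: pi => p p0; field; rewrite p0 gt_eqF.
  have pn : 0 < pi / nu%:R :> R by rewrite divr_gt0.
  rewrite normrM (@gtr0_norm _ (2 * _)) ?(mulr_gt0 _ pn)//.
  have : `|w - 2^-1 - k%:R| <= 2^-1 by rewrite ler_norml; rewrite -natr1 in wk; lra.
  nra.
have main j : cos (2 * pi * j / nu%:R) = cos (2 * pi * k%:R / nu%:R) ->
    sin (2 * pi * j / nu%:R) = sin (2 * pi * k%:R / nu%:R) ->
    cos (pi / nu%:R) * r <= x * cos (2 * pi * j / nu%:R) + y * sin (2 * pi * j / nu%:R).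
  move=> -> ->; rewrite xE yE -!mulrA -mulrDr -cosB mulrC ler_wpM2l//.
  apply: cos_le_of_norm_le; last by rewrite !mulrA.
  by rewrite ler_pdivrMr// ler_peMr ?(ltW pi0)// ler1n.
have [knu|nuk] := ltnP k nu; first by exists (Ordinal knu); exact: main.
(* An angle close to 2 pi rounds up to [nu], which is not an index in ['I_nu]; that direction
   coincides with vertex 0. *)
have kE : k = nu.
  apply/eqP; rewrite eqn_leq nuk andbT -ltnS -(ltr_nat R) -natr1.
  have : phi * nu%:R / (2 * pi) <= nu%:R.
    by rewrite ler_pdivrMr ?mulr_gt0// mulrC ler_wpM2l// ltW.
  by move: kw; rewrite /w; lra.
exists (Ordinal nu0); apply: main => /=.
- by rewrite kE mulr0 mul0r cos0 mulfK ?gt_eqF// mulr_natl cos2pi.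
- by rewrite kE mulr0 mul0r sin0 mulfK ?gt_eqF// mulr_natl sin2pi.
Qed.

(** * Exponential sums of cosines *)

Lemma sum_expR_cos_le (R : realType) (N m : nat) (lambda theta : R) :
  (0 < N)%N -> ~~ (N %| m)%N -> ~~ (N %| 2 * m)%N -> ~~ (N %| 3 * m)%N -> `|lambda| <= 1 ->
  \sum_(i < N) expR (lambda * cos (2 * pi * (i * m)%N%:R / N%:R - theta)) <=
    N%:R * (1 + lambda ^+ 2 / 4 + lambda ^+ 4 / 8).
Proof.
move=> N0 Nm N2m N3m l1; set M := 1 + _ + _.
have N0' : (N%:R : R) != 0 by rewrite pnatr_eq0 -lt0n.
pose c (k : nat) (i : 'I_N) := cos (2 * pi * (i * (k * m))%N%:R / N%:R + (- (k%:R * theta))).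
have cE k i : c k i = cos (k%:R * (2 * pi * (i * m)%N%:R / N%:R - theta)).
  rewrite /c !natrM; congr cos; move: (pi) => p; field; exact: N0'.
(* The powers of the cosine are linearized into harmonics 1, 2, 3, whose sums over [i] vanish; only
   the constant [M] survives. *)
have term (i : 'I_N) : expR (lambda * cos (2 * pi * (i * m)%N%:R / N%:R - theta)) <=
    M + (lambda + lambda ^+ 3 / 8) * c 1%N i
    + (lambda ^+ 2 / 4 + lambda ^+ 4 / 8) * c 2%N i + lambda ^+ 3 / 24 * c 3%N i.
  rewrite !cE mul1r; set x := _ - theta.
  have c2 : cos (2 * x) = 2 * cos x ^+ 2 - 1 by rewrite mulr_natl cos_mulr2n mulr_natl.
  have c3 : cos (3 * x) = 4 * cos x ^+ 3 - 3 * cos x.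
    have -> : 3 * x = x *+ 2 + x by rewrite -mulr_natr; ring.
    rewrite cosD cos_mulr2n sin_mulr2n.
    transitivity ((2 * cos x ^+ 2 - 1) * cos x - 2 * cos x * sin x ^+ 2); first ring.
    by rewrite sin2cos2; ring.
  have xc : `|cos x| <= 1 by exact: cos_max.
  have lc : `|lambda * cos x| <= 1 by rewrite normrM mulr_ile1.
  apply: (le_trans (expR_le_deg4 lc)); rewrite /M c2 c3 !exprMn.
  (* Replacing cos^4 by cos^2 avoids a fourth harmonic. *)
  have : lambda ^+ 4 * cos x ^+ 4 <= lambda ^+ 4 * cos x ^+ 2.
    rewrite ler_wpM2l ?exprn_even_ge0// -[4%N]/(2 * 2)%N exprM expr2 ler_piMl ?sqr_ge0//.
  lra.
apply: (le_trans (ler_sum _ (fun i _ => term i))).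
clearbody M.
rewrite !big_split/= -!mulr_sumr sumr_const card_ord.
by rewrite !sum_cos_eq0 ?mul1n// !mulr0 !addr0 mulr_natl.
Qed.

(** * Moments, Chernoff bound and union bound for a random selection *)

Section RandomSelection.
Context d (T : measurableType d) (R : realType) (P : probability T R) (I : finType).
Variables (tau : R) (Omega : T -> {set I}).
Hypothesis sel : random_selection P tau Omega.

(** Each event [Omega x = A] is a finite intersection of membership events or their complements, and
    [Q] is a finite union of such events. *)
Lemma measurable_selection_pred (Q : pred {set I}) : measurable [set x | Q (Omega x)].
Proof.
have [[mE _] _] := sel.
have mA A : measurable [set x | Omega x = A].
  have -> : [set x | Omega x = A] = \bigcap_(i in [set: I])
      (if i \in A then [set x | i \in Omega x] else ~` [set x | i \in Omega x]).
    apply/seteqP; split => [x /= <- i _|x /= xA].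
      by case: ifPn => //= /negP.
    by apply/setP => i; have := xA i Logic.I; case: ifPn => //= _ /negP/negbTE.
  apply: fin_bigcap_measurable => // i _; case: ifP => _ //; exact: measurableC.
have -> : [set x | Q (Omega x)] = \bigcup_(A in [set` Q]) [set x | Omega x = A].
  by apply/seteqP; split => [x /= Qx|x [A /= QA] /= ->//]; exists (Omega x).
exact: fin_bigcup_measurable.
Qed.

Lemma probability_selection_pred (Q : pred {set I}) :
  P [set x | Q (Omega x)] = (\sum_(A | Q A) fine (P [set x | Omega x = A]))%:E.
Proof.
have mA A : measurable [set x | Omega x = A].
  have -> : [set x | Omega x = A] = [set x | Omega x == A].
    by apply/seteqP; split => x /= /eqP.
  exact: (measurable_selection_pred (pred1 A)).
have -> : [set x | Q (Omega x)] = \bigcup_(A in [set` Q]) [set x | Omega x = A].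
  by apply/seteqP; split => [x /= Qx|x [A /= QA] /= ->//]; exists (Omega x).
rewrite measure_fin_bigcup//; last by move=> A B _ _ [x [/= <-]].
rewrite -(bigfs _ (index_enum_uniq _)); last by move=> A _; rewrite mem_index_enum.
by rewrite -sumEFin; apply: eq_bigr => A _; rewrite fineK// fin_num_measure.
Qed.

(** The law of [Omega]; expectations are finite sums weighted by [p], without integrals. *)
Let p A := fine (P [set x | Omega x = A]).

Lemma selection_weight_ge0 A : 0 <= p A.
Proof. exact: fine_ge0. Qed.

Lemma sum_selection_subset (J : {set I}) : \sum_(A : {set I} | J \subset A) p A = tau ^+ #|J|.
Proof.
have [[mE indep] Ptau] := sel.
apply: EFin_inj; rewrite -(probability_selection_pred (fun A => J \subset A)).
have -> : [set x | J \subset Omega x] = \bigcap_(i in [set i | i \in J]) [set x | i \in Omega x].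
  by apply/seteqP; split => [x /= /fintype.subsetP JO i /= /JO|x /= JO]//; exact/fintype.subsetP.
rewrite indep (eq_bigr (fun=> tau%:E)); last by move=> i _; exact: Ptau.
by rewrite prodEFin prodr_const.
Qed.

(** Writing f n = (f n - 1) + 1 expands the product over [A] into a sum over subsets [J] of [A].
    After exchanging the sums, the weights of the sets containing [J] add up to tau^|J|, and the
    same expansion is read backwards. *)
Lemma expectation_prod_selection (f : I -> R) :
  \sum_(A : {set I}) p A * \prod_(n in A) f n = \prod_n (1 + tau * (f n - 1)).
Proof.
have expand (A : {set I}) : \prod_(n in A) f n = \sum_(J : {set I} | J \subset A) \prod_(n in J) (f n - 1).
  rewrite big_mkcond/= (eq_bigr (fun n => (if n \in A then f n - 1 else 0) + 1)); last first.
    by move=> n _; case: ifP => _; rewrite ?subrK ?add0r.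
  rewrite bigA_distr (bigID (fun J : {set I} => J \subset A))/= [X in _ + X]big1 ?addr0.
    apply: eq_bigr => J JA; rewrite [RHS]big_mkcond/=; apply: eq_bigr => n _.
    by case: ifP => // /(fintype.subsetP JA) ->.
  move=> J /fintype.subsetPn[n nJ nA]; rewrite (bigD1 n)//= nJ (negbTE nA).
  by rewrite mul0r.
rewrite (eq_bigr (fun A : {set I} => \sum_(J : {set I} | J \subset A) p A * \prod_(n in J) (f n - 1))).
  rewrite (exchange_big_dep xpredT)//=.
  rewrite (eq_bigr (fun J : {set I} => \prod_(n in J) (tau * (f n - 1)))).
    under [RHS]eq_bigr do rewrite addrC; rewrite bigA_distr; apply: eq_bigr => J _.
    by rewrite big_mkcond.
  by move=> J _; rewrite -mulr_suml sum_selection_subset big_split/= prodr_const.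
by move=> A _; rewrite expand mulr_sumr.
Qed.

(** Markov's inequality for exp (lambda sum X), which is at least 1 on the event, followed by 1 + y
    <= exp y in each factor. *)
Lemma chernoff_selection (X : I -> R) (lambda : R) : 0 < tau -> tau < 1 -> 0 <= lambda ->
  (P [set x | 0 <= \sum_(n in Omega x) X n]%R <=
     (expR (tau * (\sum_n expR (lambda * X n) - #|I|%:R)))%:E)%E.
Proof.
move=> tau0 tau1 l0.
rewrite (probability_selection_pred (fun A => 0 <= \sum_(n in A) X n)) lee_fin.
apply: (@le_trans _ _ (\sum_(A : {set I}) p A * \prod_(n in A) expR (lambda * X n))).
  rewrite [leRHS](bigID (fun A : {set I} => 0 <= \sum_(n in A) X n))/= ler_wpDr//.
    apply: sumr_ge0 => A _; rewrite mulr_ge0 ?selection_weight_ge0//.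
    by apply: prodr_ge0 => n _; exact: expR_ge0.
  apply: ler_sum => A A0; rewrite -[leLHS]mulr1 ler_wpM2l ?selection_weight_ge0//.
  by rewrite -expR_sum -mulr_sumr -expR0 ler_expR mulr_ge0.
rewrite expectation_prod_selection.
have -> : tau * (\sum_n expR (lambda * X n) - #|I|%:R) = \sum_n tau * (expR (lambda * X n) - 1).
  by rewrite -mulr_sumr big_split/= sumrN sumr_const.
rewrite expR_sum; apply: ler_prod => n _; rewrite expR_ge1Dx andbT.
(* Each factor is (1 - tau) + tau exp (lambda X_n), nonnegative because tau < 1. *)
have := expR_ge0 (lambda * X n); nra.
Qed.

Lemma union_bound_selection (J : finType) (S : {set J}) (Q : pred {set I})
    (D : J -> pred {set I}) (c : R) :
  (forall A, Q A -> exists2 j, j \in S & D j A) ->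
  (forall j, j \in S -> (P [set x | D j (Omega x)] <= c%:E)%E) ->
  (P [set x | Q (Omega x)] <= (#|S|%:R * c)%:E)%E.
Proof.
move=> QD Dc; rewrite probability_selection_pred lee_fin mulr_natl -sumr_const.
apply: (@le_trans _ _ (\sum_(j in S) \sum_(A | D j A) fine (P [set x | Omega x = A]))).
  rewrite (exchange_big_dep xpredT)//= big_mkcond/=; apply: ler_sum => A _.
  have p0 := selection_weight_ge0 A.
  case: ifPn => [/QD[j jS DjA]|_]; last exact: sumr_ge0.
  by rewrite (bigD1 j)/= ?jS// lerDl sumr_ge0.
by apply: ler_sum => j /Dc; rewrite probability_selection_pred lee_fin.
Qed.

End RandomSelection.

(** * The bound for one frequency and one direction *)

(* The Chernoff exponent at lambda = 2 b, with u = b^2 and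
   v = a^2 / (4 (s^2 + 1)). *)
Lemma expR_gap (R : realType) (u v : R) : 0 <= u -> v <= u - 2 * u ^+ 2 ->
  expR (- (2 * u)) * (1 + u + 2 * u ^+ 2) <= 1 - v.
Proof.
move=> u0 vu; rewrite expRN mulrC ler_pdivrMr ?expR_gt0//.
have := @expR_ge_deg2 R (2 * u); rewrite mulr_ge0// => /(_ isT) e2.
(* The product equals 1 + u + 2 u^2 + 2 u^3 + 4 u^4; its factors are bounded by 1 - v and exp (2
   u). *)
apply: (@le_trans _ _ ((1 - u + 2 * u ^+ 2) * (1 + 2 * u + (2 * u) ^+ 2 / 2))).
  have : 0 <= u ^+ 3 by rewrite exprn_ge0.
  have : 0 <= u ^+ 4 by rewrite exprn_ge0.
  lra.
apply: ler_pM => //; [nra|nra|lra].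
Qed.

Lemma sum_Zp (R : realType) (N : nat) (F : nat -> R) : (1 < N)%N ->
  \sum_(n : 'Z_N) F n = \sum_(i < N) F i.
Proof. by case: N => [|[|N]]. Qed.

Section DirectionBound.
Context d (T : measurableType d) (R : realType) (P : probability T R) (s N : nat).
Variables (C tau a : R) (Omega : T -> {set 'Z_N}).
Hypotheses (s1 : (1 <= s)%N) (N1 : (1 < N)%N) (N2 : ~~ (2 %| N)%N) (N3 : ~~ (3 %| N)%N).
Hypotheses (tau0 : 0 < tau) (tau1 : tau < 1) (sel : random_selection P tau Omega).
Hypothesis tauN : tau * N%:R = 4 * C * (s%:R ^+ 2 + 1) * ln (N%:R).
Hypotheses (a0 : 0 <= a) (a1 : a <= 1).

Lemma direction_bound (t : 'Z_N) (theta : R) : t != 0 ->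
  (P [set x | a / (2 * s%:R) * #|Omega x|%:R <=
      \sum_(n in Omega x) cos (2 * pi * (n * t)%N%:R / N%:R - theta)]%R <=
    (N%:R `^ (- (C * a ^+ 2)))%:E)%E.
Proof.
move=> tn0; set b := a / (2 * s%:R).
have s1' : 1 <= s%:R :> R by rewrite ler1n.
have s0 : 0 < s%:R :> R by rewrite ltr0n.
have N0' : 0 < N%:R :> R by rewrite ltr0n ltnW.
pose X (n : 'Z_N) := cos (2 * pi * (n * t)%N%:R / N%:R - theta) - b.
have -> : [set x | b * #|Omega x|%:R <=
      \sum_(n in Omega x) cos (2 * pi * (n * t)%N%:R / N%:R - theta)] =
    [set x | 0 <= \sum_(n in Omega x) X n].
  by apply/seteqP; split => x /=; rewrite /X big_split/= sumrN sumr_const subr_ge0 mulr_natr.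
pose lambda := a / s%:R.
have l0 : 0 <= lambda by rewrite divr_ge0// ltW.
have l1 : lambda <= 1 by rewrite ler_pdivrMr// mul1r (le_trans a1).
apply: (le_trans (chernoff_selection sel X tau0 tau1 l0)).
rewrite lee_fin /powR (gt_eqF N0') ler_expR.
(* [v] is chosen so that tau N v = C a^2 log N exactly. *)
pose u := b ^+ 2; pose v := a ^+ 2 / (4 * (s%:R ^+ 2 + 1)).
have tN : (t < N)%N by have := ltn_ord t; rewrite [X in (_ < X)%N]Zp_cast.
have tpos : (0 < t)%N by rewrite lt0n -val_eqE in tn0 *.
have Nt : ~~ (N %| t)%N by rewrite gtnNdvd.
have sumX : \sum_n expR (lambda * X n) <= N%:R * (1 - v).
  have -> : \sum_n expR (lambda * X n) = expR (- (2 * u)) *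
      \sum_(i < N) expR (lambda * cos (2 * pi * (i * t)%N%:R / N%:R - theta)).
    rewrite -(sum_Zp (fun i => expR (lambda * cos (2 * pi * (i * t)%N%:R / N%:R - theta))) N1).
    rewrite mulr_sumr; apply: eq_bigr => n _; rewrite -expRD; congr expR.
    rewrite /X mulrBr addrC; congr (_ + _); congr (- _).
    by rewrite /lambda /u /b; field; rewrite gt_eqF.
  have N2t : ~~ (N %| 2 * t)%N by rewrite Gauss_dvdr// coprime_sym prime_coprime.
  have N3t : ~~ (N %| 3 * t)%N by rewrite Gauss_dvdr// coprime_sym prime_coprime.
  have nl1 : `|lambda| <= 1 by rewrite ger0_norm.
  have cos_le := sum_expR_cos_le theta (ltnW N1) Nt N2t N3t nl1.
  apply: (le_trans (ler_wpM2l (expR_ge0 _) cos_le)); rewrite mulrCA ler_wpM2l ?(ltW N0')//.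
  have -> : 1 + lambda ^+ 2 / 4 + lambda ^+ 4 / 8 = 1 + u + 2 * u ^+ 2.
    by rewrite /u /b /lambda; field; rewrite gt_eqF.
  apply: expR_gap; first exact: sqr_ge0.
  rewrite -subr_ge0.
  have S1 : 1 <= s%:R ^+ 2 :> R by rewrite exprn_ege1.
  (* The gap between 1 / s^2 and 1 / (s^2 + 1) absorbs the quartic term 2 u^2: the last factor is
     nonnegative because a^2 <= 1 <= s^2. *)
  have -> : u - 2 * u ^+ 2 - v = a ^+ 2 / (8 * (s%:R ^+ 2) ^+ 2 * (s%:R ^+ 2 + 1)) *
      (2 * s%:R ^+ 2 - a ^+ 2 * (s%:R ^+ 2 + 1)).
    by rewrite /v /u /b; field; rewrite !gt_eqF//; lra.
  have a2 : a ^+ 2 <= 1 by rewrite exprn_ile1.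
  by rewrite mulr_ge0 ?divr_ge0 ?mulr_ge0 ?sqr_ge0//; nra.
have -> : #|'Z_N| = N by rewrite card_ord Zp_cast.
apply: (@le_trans _ _ (tau * (- (N%:R * v)))).
  by rewrite ler_wpM2l ?(ltW tau0)//; lra.
rewrite mulrN mulrA tauN mulNr lerN2 /v.
rewrite [leRHS](_ : _ = C * a ^+ 2 * ln N%:R)//.
have : s%:R ^+ 2 + 1 != 0 :> R by rewrite gt_eqF// ltr_wpDl// sqr_ge0.
by move=> S0; field.
Qed.

End DirectionBound.

(** * Real form of [K] and the final union bound *)

Lemma sum_complex (R : realType) (I : finType) (A : {set I}) (f g : I -> R) :
  \sum_(n in A) (f n +i* g n)%C = ((\sum_(n in A) f n) +i* (\sum_(n in A) g n))%C.
Proof.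
apply/esym; by elim/big_rec3: _ => // n x y z _ <-.
Qed.

Lemma K_at0 (R : realType) (N : nat) (A : {set 'Z_N}) : K R A 0 = #|A|%:R.
Proof.
rewrite /K (eq_bigr (fun=> 1)); first by rewrite sumr_const.
by move=> n _; rewrite muln0 /e mul0r mulr0 cos0 sin0.
Qed.

Lemma KE (R : realType) (N : nat) (A : {set 'Z_N}) (t : 'Z_N) :
  K R A t = ((\sum_(n in A) cos (2 * pi * (n * t)%N%:R / N%:R)) +i*
             (\sum_(n in A) sin (2 * pi * (n * t)%N%:R / N%:R)))%C.
Proof.
rewrite /K -sum_complex; apply: eq_bigr => n _.
by rewrite /e [2 * pi * _]mulrA.
Qed.

Lemma large_K_direction (R : realType) (s N nu : nat) (A : {set 'Z_N}) (t : 'Z_N) :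
  (0 < nu)%N -> 0 <= cos (pi / nu%:R) :> R ->
  ~~ (`|K R A t| < (2 * s%:R)^-1 * K R A 0) ->
  exists j : 'I_nu, cos (pi / nu%:R) / (2 * s%:R) * #|A|%:R <=
    \sum_(n in A) cos (2 * pi * (n * t)%N%:R / N%:R - 2 * pi * j%:R / nu%:R) :> R.
Proof.
move=> nu0 a0; rewrite K_at0 KE normc_def /=.
set X := \sum_(n in A) _; set Y := \sum_(n in A) _.
(* Both sides are embedded reals, so the negated complex inequality becomes a real one. *)
have -> : (2 * s%:R)^-1 * #|A|%:R = ((2 * s%:R)^-1 * #|A|%:R : R)%:C%C.
  by rewrite rmorphM fmorphV rmorphM !rmorph_nat.
rewrite ltcR -leNgt => KX; have [j Hj] := polygon_direction X Y nu0; exists j.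
apply: (le_trans (y := cos (pi / nu%:R) * Num.sqrt (X ^+ 2 + Y ^+ 2))).
  by rewrite -mulrA ler_wpM2l.
apply: (le_trans Hj); rewrite le_eqVlt; apply/orP; left; apply/eqP.
(* The projection of K(t) onto the direction is the sum of the shifted cosines. *)
by rewrite !mulr_suml -big_split/=; apply: eq_bigr => n _; rewrite cosB.
Qed.

(* |K(t)| < K(0) / (2 s) is an inequality in R[i], whose order is: equal
   imaginary parts and < on real parts; here both sides are real.
   N = 1 is excluded by 0 < tau and tau * N = 4 C (s^2 + 1) log N. *)
Theorem mainTheorem2 (R : realType) (d : measure_display) (T : measurableType d)
    (P : probability T R) (s N : nat) (C tau : R) (Omega : T -> {set 'Z_N})
    (nu : nat) :
  (1 <= s)%N ->
  (0 < N)%N -> ~~ (2 %| N)%N -> ~~ (3 %| N)%N ->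
  1 < C ->
  0 < tau -> tau < 1 ->
  random_selection P tau Omega ->
  tau * N%:R = 4 * C * (s%:R ^+ 2 + 1) * ln (N%:R) ->
  (3 <= nu)%N ->
  let a : R := cos (pi / nu%:R) in
  let delta : R := C * a ^+ 2 - 1 in
  ((1 - nu%:R * (N%:R `^ (- delta)))%:E <
    P [set x | (forall t : 'Z_N, t != 0 ->
        `|K R (Omega x) t| < (2 * s%:R)^-1 * K R (Omega x) 0)%R])%E.
Proof.
move=> s1 N0 N2 N3 C1 tau0 tau1 sel tauN nu3 /=.
set a : R := cos (pi / nu%:R); set delta : R := C * a ^+ 2 - 1.
have N1 : (1 < N)%N.
  rewrite ltn_neqAle N0 andbT; apply/eqP => NE.
  by move: tauN; rewrite -NE mulr1 ln1 mulr0 => tau_eq0; rewrite tau_eq0 ltxx in tau0.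
have nu0 : (0 < nu)%N by exact: leq_trans nu3.
have nu0' : 0 < nu%:R :> R by rewrite ltr0n.
have pi0 := pi_gt0 R.
have a0 : 0 < a.
  rewrite cos_gt0_pihalf// ltr_pM2l// ltf_pV2 ?posrE// ltr_nat nu3 andbT.
  by rewrite (lt_trans (y := 0)) ?divr_gt0// oppr_lt0 divr_gt0.
pose good (A : {set 'Z_N}) :=
  [forall t : 'Z_N, (t != 0) ==> (`|K R A t| < (2 * s%:R)^-1 * K R A 0)].
have -> : [set x | forall t : 'Z_N, t != 0 ->
    `|K R (Omega x) t| < (2 * s%:R)^-1 * K R (Omega x) 0] =
    ~` [set x | ~~ good (Omega x)].
  apply/seteqP; split => x /=.
    by move=> H /negP; apply; apply/forallP => t; apply/implyP; exact: H.
  by move=> /negP; rewrite negbK => /forallP H t; exact: implyP (H t).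
rewrite probability_setC; last exact: (measurable_selection_pred sel (fun A => ~~ good A)).
pose c : R := N%:R `^ (- (C * a ^+ 2)).
pose S : {set 'Z_N * 'I_nu} := finset.setX (~: [set 0])%SET [set: 'I_nu]%SET.
pose D (tj : 'Z_N * 'I_nu) : pred {set 'Z_N} := fun A => a / (2 * s%:R) * #|A|%:R <=
  \sum_(n in A) cos (2 * pi * (n * tj.1)%N%:R / N%:R - 2 * pi * tj.2%:R / nu%:R).
have bound : (P [set x | ~~ good (Omega x)] <= (#|S|%:R * c)%:E)%E.
  apply: (union_bound_selection sel (Q := fun A => ~~ good A) (D := D)).
    move=> A /forallPn[t]; rewrite negb_imply => /andP[t0 /large_K_direction].
    move=> /(_ nu nu0 (ltW a0))[j Dj]; exists (t, j) => //.
    by rewrite /S !inE/= t0.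
  move=> [t j]; rewrite /S !inE/= andbT => t0.
  exact: (direction_bound s1 N1 N2 N3 tau0 tau1 sel tauN (ltW a0) (cos_le1 _)).
have cardS : (#|S| = N.-1 * nu)%N.
  by rewrite cardsX cardsC1 cardsT !card_ord Zp_cast.
have N0' : 0 < N%:R :> R by rewrite ltr0n.
have c0 : 0 < c by rewrite powR_gt0.
have -> : N%:R `^ (- delta) = N%:R * c.
  rewrite /delta opprB powRD ?powRr1 ?ler0n//.
  by rewrite (gt_eqF N0') implybT.
(* Strictness comes from the count: there are only N - 1 nonzero frequencies, and (N - 1) nu c < nu
   N c. *)
apply: (@lt_le_trans _ _ (1 - #|S|%:R * c)%:E); last first.
  by rewrite EFinB leeB.
rewrite lte_fin ltrD2l ltrN2 cardS mulrA ltr_pM2r// -natrM ltr_nat mulnC.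
by rewrite ltn_pmul2l// ltn_predL.
Qed.
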